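(* Let $n\geq 1$ be an integer and let $d\in\{0,1,\ldots,n-1\}$. Then $$\sum_{k=0}^{n-1}q^{k}{2k\brack k+d}_q(-q^{k+1}; q)_{n-k-1}\equiv\begin{cases}0, &\text{if } n-d \text{ is even}\\ (-1)^{\frac{n+d-1}{2}}q^{\frac{d(2n-3d)-(n+1)^2}{4}}, &\text{if } n-d \text{ is odd}\end{cases}\pmod{\Phi_n(q)},$$ $$\sum_{k=0}^{n-1}q^{k}{2k\brack k+d}_q(-q^{k}; q)_{n-k-1}\equiv\begin{cases}(-1)^{\frac{n+d}{2}}q^{\frac{d(2n-3d)-n^2+2d}{4}}\dfrac{1-q^{n-d}}{1+q}, &\text{if } n-d \text{ is even}\\ (-1)^{\frac{n+d-1}{2}}q^{\frac{d(2n-3d)-(n+1)^2}{4}}, &\text{if } n-d \text{ is odd}\end{cases}\pmod{\Phi_n(q)}.$$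
   Context: $(z;q)_n=(1-z)(1-zq)\cdots(1-zq^{n-1})$ for $n\ge 0$ (with $(z;q)_0=1$). ${n\brack k}_q$ is the $q$-binomial coefficient, equal to $\frac{(q;q)_n}{(q;q)_k(q;q)_{n-k}}$ if $0\le k\le n$ and $0$ otherwise; it is a polynomial in $q$ with integer coefficients. $\Phi_n(q)$ is the $n$th cyclotomic polynomial. Congruences are between Laurent polynomials, i.e. in the ring $\mathbb{Z}[q,q^{-1}]$; when $n-d$ is even, $(1-q^{n-d})/(1+q)$ is a polynomial in $q$. *)

(* Defs.v *)
From HB Require Import structures.
From mathcomp Require Export all_boot all_order all_algebra all_field.

Set Implicit Arguments.
Unset Strict Implicit.
Unset Printing Implicit Defensive.

Import Order.TTheory GRing.Theory Num.Theory.
Local Open Scope ring_scope.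

(* Laurent polynomials in q over the integers are viewed inside the field of
   fractions of Z[q], where negative powers of q and quotients such as
   (1 - q^(n-d)) / (1 + q) make sense literally. *)
Notation Zq_frac := {fraction {poly int}}.

Definition qvar : Zq_frac := FracField.tofrac 'X.

Definition is_laurent (x : Zq_frac) : Prop :=
  exists (p : {poly int}) (m : nat), x = FracField.tofrac p / qvar ^+ m.

(* Congruence in the ring Z[q, q^-1]: both sides and the cofactor are required
   to lie in that ring (divisibility in the whole field would be vacuous). *)
Definition laurent_eqmod (m : {poly int}) (x y : Zq_frac) : Prop :=
  [/\ is_laurent x, is_laurent y &
      exists2 g : Zq_frac, is_laurent g & x - y = FracField.tofrac m * g].

Definition qpoch (R : pzRingType) (z q : R) (n : nat) : R :=
  \prod_(i < n) (1 - z * q ^+ i).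

(* Division by zero does not occur for the indeterminate q = qvar. *)
Definition qbinom (F : fieldType) (q : F) (n k : nat) : F :=
  if (k <= n)%N then qpoch q q n / (qpoch q q k * qpoch q q (n - k)) else 0.

(* Main.v *)
(* Put B_k(d) = [2k, k+d]_q, w_k = (-q^(k+1); q)_(n-k-1),
   s(d) = sum_k q^k B_k(d) w_k and M(d) = sum_k q^(2k) B_k(d) w_k (k < n).
   The ratio B_k(d+1)/B_k(d) gives a linear relation between M(d), M(d+1), s(d)
   and s(d+1), and the recurrence for B_(k+1)(d) in terms of B_k(d-1), B_k(d)
   and B_k(d+1) gives, after summation in k, one between s(d-1), s(d), s(d+1),
   M(d) and the boundary term B_n(d). At a primitive n-th root of unity B_n(d)
   vanishes for 0 < d < n, so both relations determine s and M by descending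
   induction from d = n, and closed forms follow. The second sum S' satisfies
   (1 + q^(n-1)) S' = s + M, which determines it except when n = 2, where the
   factor vanishes. Finally, a polynomial in Z[q] vanishing at a primitive n-th
   root of unity is a multiple of the cyclotomic polynomial. *)
From HB Require Import structures.
Require Import Defs.
From mathcomp Require Import all_boot all_order all_algebra all_field.
From mathcomp Require Import ring zify.

Import Order.TTheory GRing.Theory Num.Theory.
Local Open Scope ring_scope.

Set Implicit Arguments.
Unset Strict Implicit.
Unset Printing Implicit Defensive.

Section Definitions.
Variables (R : pzRingType) (q : R).

(** Built on the Pascal rule, without division, so that it can be specialised at roots of unity,
    where denominators of [qbinom] may vanish. *)
Fixpoint gauss (n k : nat) : R :=
  match n, k with
  | _, 0 => 1
  | 0, _.+1 => 0
  | n'.+1, k'.+1 => gauss n' k' + q ^+ k * gauss n' k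
  end.

(* The two sums of the statement are [qsum_shift] and [qsum 1]; the companion
   sum [qsum 2] links them and closes the recurrences in [d]. *)
Definition qsum (c n d : nat) : R :=
  \sum_(0 <= k < n) q ^+ (c * k) * gauss (2 * k) (k + d)
    * qpoch (- q ^+ k.+1) q (n - k - 1).

Definition qsum_shift (n d : nat) : R :=
  \sum_(0 <= k < n) q ^+ k * gauss (2 * k) (k + d)
    * qpoch (- q ^+ k) q (n - k - 1).

End Definitions.

(** * Gaussian binomials and relations between the sums, over a commutative ring *)

Section Ring.
Variables (R : comNzRingType) (q : R).
Implicit Types n k d : nat.

Lemma gaussn0 n : gauss q n 0 = 1. Proof. by case: n. Qed.

Lemma gaussSS n k :
  gauss q n.+1 k.+1 = gauss q n k + q ^+ k.+1 * gauss q n k.+1.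
Proof. by []. Qed.

Lemma gauss_small n k : (n < k)%N -> gauss q n k = 0.
Proof.
elim: n k => [|n IHn] [|k] // lt_nk.
by rewrite gaussSS !IHn ?mulr0 ?addr0 //; lia.
Qed.

Lemma gaussnn n : gauss q n n = 1.
Proof.
elim: n => // n IHn.
by rewrite gaussSS IHn gauss_small // mulr0 addr0.
Qed.

Lemma gauss_mul_left n k :
  (1 - q ^+ k.+1) * gauss q n k.+1 = (1 - q ^+ (n - k)) * gauss q n k.
Proof.
(* The claim in row [m] gives the diagonal absorption rule in row [m.+1], which drives the induction
   on [n]. *)
have diag m j : (1 - q ^+ j.+1) * gauss q m j.+1 = (1 - q ^+ (m - j)) * gauss q m j ->
    (1 - q ^+ j.+1) * gauss q m.+1 j.+1 = (1 - q ^+ m.+1) * gauss q m j.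
  move=> Hmj; have [le_jm | lt_mj] := leqP j m; last first.
    by rewrite gaussSS !(@gauss_small m) //; [ring | lia].
  rewrite gaussSS mulrDr mulrCA Hmj.
  have -> : q ^+ m.+1 = q ^+ j.+1 * q ^+ (m - j) by rewrite -exprD; congr (_ ^+ _); lia.
  ring.
elim: n k => [|n IHn] k.
  by rewrite sub0n expr0; case: k => [|k] /=; ring.
rewrite diag //; case: k => [|k]; first by rewrite !gaussn0 subn0.
have [le_kn | lt_nk] := leqP k n; last first.
  by rewrite !gauss_small ?mulr0 //; lia.
rewrite subSS gaussSS mulrDr -IHn.
have -> : q ^+ n.+1 = q ^+ (n - k) * q ^+ k.+1 by rewrite -exprD; congr (_ ^+ _); lia.
ring.
Qed.

Lemma gauss_mul_diag n k :
  (1 - q ^+ k.+1) * gauss q n.+1 k.+1 = (1 - q ^+ n.+1) * gauss q n k.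
Proof.
have [le_kn | lt_nk] := leqP k n; last first.
  by rewrite !gauss_small ?mulr0 //; lia.
rewrite gaussSS mulrDr mulrCA gauss_mul_left.
have -> : q ^+ n.+1 = q ^+ k.+1 * q ^+ (n - k) by rewrite -exprD; congr (_ ^+ _); lia.
ring.
Qed.

Lemma gaussSS' n k :
  gauss q n.+1 k.+1 = q ^+ (n - k) * gauss q n k + gauss q n k.+1.
Proof.
apply/eqP; rewrite gaussSS -subr_eq0; apply/eqP.
have := gauss_mul_left n k; set a := gauss q n k; set b := gauss q n k.+1.
move=> Hab; transitivity ((1 - q ^+ (n - k)) * a - (1 - q ^+ k.+1) * b); first by ring.
by rewrite Hab subrr.
Qed.

(** Two Pascal steps leave the last coefficient with a surplus factor [q ^+ (k + e).+2];
    [gauss_mul_left] removes it and corrects the middle coefficient. The factor [q ^+ e] keeps all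
    exponents nonnegative. *)
Lemma gauss_central_rec k e :
  q ^+ e * gauss q (2 * k.+1) (k.+1 + e.+1) =
    q ^+ k * gauss q (2 * k) (k + e)
    + q ^+ e * (1 + q ^+ (2 * k + 1)) * gauss q (2 * k) (k + e.+1)
    + q ^+ (k + 2 * e + 2) * gauss q (2 * k) (k + e.+2).
Proof.
have -> : (2 * k.+1 = (2 * k).+2)%N by lia.
have -> : (k.+1 + e.+1 = (k + e).+2)%N by lia.
have -> : (k + e.+2 = (k + e).+2)%N by lia.
have -> : (k + e.+1 = (k + e).+1)%N by lia.
have [lt_ke | le_ek] := ltnP k e.
  by rewrite !gauss_small; [ring | lia..].
rewrite gaussSS gaussSS' (gaussSS (2 * k) (k + e).+1).
move: (gauss_mul_left (2 * k) (k + e).+1).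
set a := gauss q _ (k + e); set b := gauss q _ (k + e).+1; set c := gauss q _ (k + e).+2.
have Ek : q ^+ e * q ^+ (2 * k - (k + e)) = q ^+ k by rewrite -exprD; congr (_ ^+ _); lia.
have [lt_ek | ?] := ltnP e k; last first.
  have -> : b = 0 by apply: gauss_small; lia.
  have -> : c = 0 by apply: gauss_small; lia.
  by rewrite -Ek => _; ring.
move=> Hbc.
have Ec : q ^+ (k + e).+2 * c = c - (1 - q ^+ (2 * k - (k + e).+1)) * b.
  by rewrite -Hbc; ring.
have Eb : q ^+ (k + e).+2 * q ^+ (2 * k - (k + e).+1) = q ^+ (2 * k + 1).
  by rewrite -exprD; congr (_ ^+ _); lia.
have Ex : q ^+ e * q ^+ (k + e).+2 = q ^+ (k + 2 * e + 2).
  by rewrite -exprD; congr (_ ^+ _); lia.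
by rewrite -Ek -Eb -Ex Ec; ring.
Qed.

Lemma qpochSr z n : qpoch z q n.+1 = qpoch z q n * (1 - z * q ^+ n).
Proof. by rewrite /qpoch big_ord_recr. Qed.

Lemma qpochSl z n : qpoch z q n.+1 = (1 - z) * qpoch (z * q) q n.
Proof.
rewrite /qpoch big_ord_recl expr0 mulr1; congr (_ * _).
by apply: eq_bigr => i _; rewrite -mulrA -exprS.
Qed.

(** Every weight gains the same last factor [1 + q ^+ n], so inductions on [n] need no further work
    on products. *)
Lemma qsumS c n d :
  qsum q c n.+1 d = (1 + q ^+ n) * qsum q c n d + q ^+ (c * n) * gauss q (2 * n) (n + d).
Proof.
rewrite /qsum big_nat_recr //= (_ : n.+1 - n - 1 = 0)%N; last lia.
rewrite {2}/qpoch big_ord0 mulr1 mulr_sumr; congr (_ + _).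
apply: eq_big_nat => k /andP[_ lt_kn].
rewrite (_ : n.+1 - k - 1 = (n - k - 1).+1)%N; last lia.
rewrite qpochSr (_ : q ^+ n = q ^+ k.+1 * q ^+ (n - k - 1)); first by ring.
by rewrite -exprD; congr (_ ^+ _); lia.
Qed.

Lemma qsum_small c n d : (n <= d)%N -> qsum q c n d = 0.
Proof.
move=> le_nd; rewrite /qsum big_nat big1 // => k /andP[_ lt_kn].
by rewrite gauss_small ?mulr0 ?mul0r //; lia.
Qed.

(** The relation already holds summand by summand, as a multiple of [gauss_mul_left]. *)
Lemma qsum_step n d :
  q ^+ (2 * d + 1) * qsum q 2 n d.+1 - qsum q 2 n d =
  q ^+ d * (qsum q 1 n d.+1 - qsum q 1 n d).
Proof.
elim: n => [|n IHn]; first by rewrite !qsum_small //; ring.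
rewrite !qsumS mul1n (addnS n d).
have E : q ^+ (2 * d + 1) * q ^+ (2 * n) * gauss q (2 * n) (n + d).+1 
     - q ^+ (2 * n) * gauss q (2 * n) (n + d)
    = q ^+ (d + n) * (gauss q (2 * n) (n + d).+1 - gauss q (2 * n) (n + d)).
  have [lt_nd | le_dn] := ltnP n d; first by rewrite !gauss_small; [ring | lia..].
  have := gauss_mul_left (2 * n) (n + d).
  set a := gauss q _ (n + d); set b := gauss q _ _.+1 => Hab.
  have -> : q ^+ (2 * d + 1) * q ^+ (2 * n) = q ^+ (d + n) * q ^+ (n + d).+1.
    by rewrite -!exprD; congr (_ ^+ _); lia.
  have -> : q ^+ (2 * n) = q ^+ (d + n) * q ^+ (2 * n - (n + d)).
    by rewrite -!exprD; congr (_ ^+ _); lia.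
  apply/eqP; rewrite -subr_eq0; apply/eqP.
  transitivity (q ^+ (d + n) * ((1 - q ^+ (2 * n - (n + d))) * a - (1 - q ^+ (n + d).+1) * b)); first by ring.
  by rewrite Hab subrr mulr0.
transitivity ((1 + q ^+ n) * (q ^+ (2 * d + 1) * qsum q 2 n d.+1 - qsum q 2 n d)
  + q ^+ (d + n) * (gauss q (2 * n) (n + d).+1 - gauss q (2 * n) (n + d))).
  by rewrite -E; ring.
by rewrite IHn exprD; ring.
Qed.

(** This is [gauss_central_rec] summed over [k]; the shift from [k] to [k.+1] leaves the boundary
    term [gauss q (2 * n) (n + d.+1)]. *)
Lemma qsum_three_term n d :
  q ^+ d * (qsum q 1 n d.+1 + gauss q (2 * n) (n + d.+1)) =
  qsum q 1 n d + q ^+ d.+1 * qsum q 2 n d.+1 + q ^+ (2 * d + 2) * qsum q 1 n d.+2.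
Proof.
elim: n => [|n IHn]; first by rewrite !qsum_small //= ; ring.
have := gauss_central_rec n d; rewrite !qsumS mul1n.
set a := gauss q (2 * n) _; set b := gauss q (2 * n) _; set c := gauss q (2 * n) _.
move=> E; rewrite mulrDr E.
transitivity ((1 + q ^+ n) * (q ^+ d * (qsum q 1 n d.+1 + b))
  + q ^+ n * a + q ^+ d.+1 * q ^+ (2 * n) * b + q ^+ (2 * d + 2) * q ^+ n * c).
  by rewrite -!exprD !addn1 !exprS !exprD; ring.
by rewrite IHn; ring.
Qed.

(** One product with factors from [1 + q ^+ k] to [1 + q ^+ n] is split at either end; the factor
    [1 + q ^+ k] then yields the two sums. *)
Lemma qsum_shiftE n d :
  (1 + q ^+ n) * qsum_shift q n.+1 d = qsum q 1 n.+1 d + qsum q 2 n.+1 d.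
Proof.
rewrite /qsum_shift /qsum -big_split mulr_sumr /=.
apply: eq_big_nat => k /andP[_ lt_kn].
have := qpochSl (- q ^+ k) (n.+1 - k - 1).
rewrite qpochSr (mulNr (q ^+ k) (q ^+ _)) -exprD (_ : k + _ = n)%N; last lia.
rewrite mulNr -exprSr !opprK => E; rewrite !mul1n.
transitivity (q ^+ k * gauss q (2 * k) (k + d) * (qpoch (- q ^+ k) q (n.+1 - k - 1) * (1 + q ^+ n))).
  by ring.
by rewrite E mul2n -addnn exprD; ring.
Qed.

End Ring.

(** * Values of the sums at a primitive root of unity *)

Section PrimitiveRoot.
Variables (F : fieldType) (n : nat) (z : F).
Hypothesis z_prim : n.-primitive_root z.
Implicit Types d j : nat.

Let n_gt0 : (0 < n)%N. Proof. exact: prim_order_gt0 z_prim. Qed.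

Lemma prim_root_neq0 : z != 0.
Proof.
apply/eqP => z0; have /eqP := prim_expr_order z_prim.
by rewrite z0 expr0n gtn_eqF // eq_sym oner_eq0.
Qed.

(** In the absorption rule [1 - z ^+ (2 * n)] vanishes while [1 - z ^+ (n + d) = 1 - z ^+ d] does
    not. *)
Lemma gauss_prim_root d : (0 < d < n)%N -> gauss z (2 * n) (n + d) = 0.
Proof.
case: d => // d /= lt_dn.
have := gauss_mul_diag z (2 * n).-1 (n + d).
rewrite (_ : (2 * n).-1.+1 = 2 * n)%N -?addnS; last lia.
rewrite (mulnC 2) [z ^+ (n * 2)]exprM exprD !(prim_expr_order z_prim) expr1n subrr mul0r mul1r.
move/eqP; rewrite mulf_eq0 => /orP[|/eqP //].
by rewrite subr_eq0 eq_sym -(prim_order_dvd z_prim) gtnNdvd.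
Qed.

(** For odd [n] the exponent is a multiple of [n]; for even [n], [z ^+ n./2 = -1]. *)
Lemma prim_root_bin2 : z ^+ 'C(n, 2) = (-1) ^+ n.-1.
Proof.
have [n_odd | n_even] := boolP (odd n).
  have -> : 'C(n, 2) = (n * n.-1./2)%N by rewrite bin2 -{1}(_ : n.-1./2.*2 = n.-1)%N -?doubleMr ?doubleK; lia.
  by rewrite exprM (prim_expr_order z_prim) expr1n -signr_odd; have -> : odd n.-1 = false by lia.
have -> : 'C(n, 2) = (n./2 * n.-1)%N by rewrite bin2 -{1}(_ : n./2.*2 = n)%N -?doubleMl ?doubleK; lia.
rewrite exprM; congr (_ ^+ _).
have : (z ^+ n./2) ^+ 2 == 1.
  by rewrite -exprM (_ : n./2 * 2 = n)%N ?(prim_expr_order z_prim) //; lia.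
rewrite sqrf_eq1 => /orP[|/eqP //].
by rewrite -(prim_order_dvd z_prim) gtnNdvd //; lia.
Qed.

(** The closed form for [n - d = 2 * j + 1]: once [z ^+ n = 1] is used, neither [n] nor [d] is left
    in it. *)
Definition odd_value j := (-1) ^+ j / z ^+ (3 * j * j.+1).+1.

Lemma odd_valueS j : odd_value j = - (z ^+ (2 * j.+1)) ^+ 3 * odd_value j.+1.
Proof.
rewrite /odd_value -exprM.
have -> : (3 * j.+1 * j.+2).+1 = ((3 * j * j.+1).+1 + 2 * j.+1 * 3)%N by lia.
rewrite exprD (exprS (-1)); field.
by rewrite !expf_neq0 ?prim_root_neq0.
Qed.

(** The even case [j] yields the odd case [j], and both yield the even case [j.+1]: each time
    [qsum_three_term] gives [qsum z 1], then [qsum_step] gives [qsum z 2]. *)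
Lemma qsum_prim_root j d :
  ((d + 2 * j = n)%N -> qsum z 1 n d = 0
     /\ qsum z 2 n d = z ^+ (2 * j) * (z ^+ (2 * j) - 1) * odd_value j)
  /\ ((d + (2 * j).+1 = n)%N -> qsum z 1 n d = odd_value j /\ qsum z 2 n d = odd_value j / z).
Proof.
have z0 := prim_root_neq0.
(* The second premise isolates what differs between [i = 0], where the boundary term is 1, and
   [i > 0], where it vanishes and [qsum z 1 n e.+2] contributes. *)
have even_odd i : 
    (forall e, (e + 2 * i = n)%N -> qsum z 1 n e = 0
     /\ qsum z 2 n e = z ^+ (2 * i) * (z ^+ (2 * i) - 1) * odd_value i) ->
    (forall e, (e + (2 * i).+1 = n)%N -> 
      z ^+ e * gauss z (2 * n) (n + e.+1) - z ^+ (2 * e + 2) * qsum z 1 n e.+2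
      = z ^+ (2 * i) * odd_value i) ->
    (forall e, (e + (2 * i).+1 = n)%N -> 
      qsum z 1 n e = odd_value i /\ qsum z 2 n e = odd_value i / z).
  move=> ev Hs e en.
  have [s1 m1] := ev e.+1 ltac:(lia).
  have x0 : z ^+ (2 * i) != 0 by rewrite expf_neq0.
  (* Since [z ^+ n = 1], all powers become rational in [z] and [z ^+ (2 * i)], within reach of
     [field]. *)
  have ze : z ^+ e = (z ^+ (2 * i) * z)^-1.
    apply: (mulIf (expf_neq0 (2 * i).+1 z0)).
    by rewrite -exprD en (prim_expr_order z_prim) exprSr mulVf // mulf_neq0.
  have s0 : qsum z 1 n e = odd_value i.
    have := qsum_three_term z n e; rewrite s1 m1 add0r => H3.
    apply: (addIr (z ^+ e.+1 * (z ^+ (2 * i) * (z ^+ (2 * i) - 1) * odd_value i))).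
    by have := Hs e en; rewrite H3 addrK => ->; rewrite exprS ze; field; rewrite z0 x0.
  split=> //; have := qsum_step z n e; rewrite s1 m1 s0 => Hm.
  apply: oppr_inj; apply: (addrI (z ^+ (2 * e + 1) * (z ^+ (2 * i) * (z ^+ (2 * i) - 1) * odd_value i))).
  by rewrite Hm (mulnC 2 e) (exprD z (e * 2)) (exprM z e) ze; field; rewrite z0 x0.
elim: j d => [|j IHj] d.
  split.
- rewrite addn0 => ->; rewrite !qsum_small //; split=> //; ring.
- apply: even_odd => [e|e en].
    rewrite addn0 => ->; rewrite !qsum_small //; split=> //; ring.
  have Sen : e.+1 = n by lia.
  rewrite qsum_small; last lia.
  (* The boundary coefficient [gauss z (2 * n) (2 * n) = 1] is the only nonzero input of the whole
     recursion. *)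
  rewrite Sen addnn -mul2n gaussnn mulr0 subr0; apply: (mulIf z0).
  rewrite mulr1 -exprSr Sen (prim_expr_order z_prim).
  by rewrite /odd_value /=; field.
have ev e : (e + 2 * j.+1 = n)%N -> qsum z 1 n e = 0
    /\ qsum z 2 n e = z ^+ (2 * j.+1) * (z ^+ (2 * j.+1) - 1) * odd_value j.+1.
  move=> en; have [s1 m1] := (IHj e.+1).2 ltac:(lia).
  have [s2 _] := (IHj e.+2).1 ltac:(lia).
  have B0 : gauss z (2 * n) (n + e.+1) = 0 by apply: gauss_prim_root; lia.
  have := qsum_three_term z n e; have := qsum_step z n e.
  rewrite s1 m1 s2 B0 mulr0 !addr0 exprS.
  have x0 : z ^+ (2 * j.+1) != 0 by rewrite expf_neq0.
  have ze : z ^+ e = (z ^+ (2 * j.+1))^-1.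
    apply: (mulIf x0).
    by rewrite -exprD en (prim_expr_order z_prim) mulVf.
  move=> Hm Hs.
  have s0 : qsum z 1 n e = 0.
    apply: (addIr (z * z ^+ e * (odd_value j / z))).
    by rewrite -Hs; field.
  split=> //; apply: oppr_inj.
  apply: (addrI (z ^+ (2 * e + 1) * (odd_value j / z))).
  rewrite Hm s0 (odd_valueS j) (mulnC 2 e) (exprD z (e * 2)) (exprM z e) ze.
  by field; rewrite z0 x0.
split; [exact: ev | apply: even_odd => // e en].
rewrite gauss_prim_root; last lia.
rewrite ((IHj e.+2).2 ltac:(lia)).1 mulr0 sub0r (odd_valueS j).
have x0 : z ^+ (2 * j.+1) != 0 by rewrite expf_neq0.
have ze : z ^+ e.+1 = (z ^+ (2 * j.+1))^-1.
  apply: (mulIf x0).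
  by rewrite -exprD (_ : _ + _ = n)%N ?(prim_expr_order z_prim) ?mulVf //; lia.
have -> : (2 * e + 2 = e.+1 * 2)%N by lia.
by rewrite (exprM z e.+1) ze; field.
Qed.
End PrimitiveRoot.

(** * Exponents and quotient of the statement *)

Definition odd_exponent (n d : nat) : int :=
  ((d%:Z * (2 * n%:Z - 3 * d%:Z) - (n%:Z + 1) ^+ 2) %/ 4)%Z.

Definition even_exponent (n d : nat) : int :=
  ((d%:Z * (2 * n%:Z - 3 * d%:Z) - n%:Z ^+ 2 + 2 * d%:Z) %/ 4)%Z.

(* [(1 - q ^+ (2 * j)) / (1 + q)], without the division, so that it also makes sense at [q = -1]. *)
Definition even_quotient (R : pzRingType) (q : R) (j : nat) : R :=
  (1 - q) * \sum_(i < j) q ^+ (2 * i).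

Lemma even_quotientE (R : comNzRingType) (q : R) j :
  (1 + q) * even_quotient q j = 1 - q ^+ (2 * j).
Proof.
rewrite exprM -[1 in RHS](expr1n _ j) subrXX mulrA; congr (_ * _); first by ring.
by apply: eq_bigr => i _; rewrite expr1n mul1r exprM.
Qed.

Lemma binz2 n : ('C(n, 2)%:Z * 2 = n%:Z * (n%:Z - 1)).
Proof. 
case: n => [|n] //; have := mul_bin_diag n.+1 1; rewrite bin1 => E.
by rewrite mulrC -[2 * _]PoszM -E PoszM intS; ring.
Qed.

(** Shows the division by 4 to be exact and separates a multiple of [n], the exponent of
    [prim_root_bin2] and that of [odd_value]. *)
Lemma odd_exponentE n d j : (d + (2 * j).+1 = n)%N ->
  odd_exponent n d = n%:Z * (2 * j)%:Z - 'C(n, 2)%:Z - (3 * j * j.+1).+1%:Z.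
Proof.
move=> dn; rewrite /odd_exponent -[RHS](@mulzK _ 4) //; congr (_ %/ _)%Z.
have := binz2 n; move: 'C(n, 2) => c Hc.
transitivity (4 * (n%:Z * (2 * j)%:Z - (3 * j * j.+1).+1%:Z) - 2 * (c%:Z * 2)); last by ring.
rewrite Hc -dn !(PoszD, PoszM, intS); ring.
Qed.

Lemma even_exponentE n d j : (d + 2 * j = n)%N ->
  even_exponent n d = n%:Z * (2 * j)%:Z - 'C(n, 2)%:Z - (3 * j * j + j)%:Z.
Proof.
move=> dn; rewrite /even_exponent -[RHS](@mulzK _ 4) //; congr (_ %/ _)%Z.
have := binz2 n; move: 'C(n, 2) => c Hc.
transitivity (4 * (n%:Z * (2 * j)%:Z - (3 * j * j + j)%:Z) - 2 * (c%:Z * 2)); last by ring.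
rewrite Hc -dn !(PoszD, PoszM); ring.
Qed.

(** * Closed forms at a primitive root, in characteristic zero *)

Section Values.
Variables (F : numFieldType) (n : nat) (z : F).
Hypothesis z_prim : n.-primitive_root z.

Lemma prim_root_exprz j k :
  z ^ (n%:Z * (2 * j)%:Z - 'C(n, 2)%:Z - k%:Z) = (-1) ^+ n.-1 / z ^+ k.
Proof.
have z0 := prim_root_neq0 z_prim.
rewrite !expfzDr // -exprz_exp -(exprnP z n) (prim_expr_order z_prim) exp1rz mul1r.
by rewrite -!exprnN (prim_root_bin2 z_prim) invr_sign.
Qed.

Lemma odd_monomialE d j : (d + (2 * j).+1 = n)%N ->
  (-1) ^+ ((n + d - 1) %/ 2) * z ^ odd_exponent n d = odd_value z j.
Proof.
move=> dn; rewrite (odd_exponentE dn) prim_root_exprz mulrA; congr (_ / _).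
rewrite (_ : (n + d - 1) %/ 2 = d + j)%N; last lia.
rewrite (_ : n.-1 = (d + j) + j)%N; last lia.
by rewrite (exprD _ (d + _)) mulrA -exprD addnn -mul2n exprM sqrrN expr1n expr1n mul1r.
Qed.

Lemma even_monomialE d j : (d + 2 * j.+1 = n)%N ->
  (-1) ^+ ((n + d) %/ 2) * z ^ even_exponent n d = (-1) ^+ j / z ^+ (3 * j.+1 * j.+1 + j.+1).
Proof.
move=> dn; rewrite (even_exponentE dn) prim_root_exprz mulrA; congr (_ / _).
rewrite (_ : (n + d) %/ 2 = d + j.+1)%N; last lia.
rewrite (_ : n.-1 = (d + j.+1) + j)%N; last lia.
by rewrite (exprD _ (d + _)) mulrA -exprD addnn -mul2n exprM sqrrN expr1n expr1n mul1r.
Qed.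

Lemma prim_root_add1_neq0 : n != 2%N -> 1 + z != 0.
Proof.
move=> n2; rewrite addrC addr_eq0; apply/eqP => zN1.
have n1 : n = 1%N.
  apply/eqP; have : (n %| 2)%N by rewrite (prim_order_dvd z_prim) zN1 sqrrN expr1n.
  by rewrite dvdn_divisors // !inE (negPf n2) orbF.
have := prim_expr_order z_prim; rewrite zN1 n1 expr1 => /eqP.
by rewrite eq_sym -addr_eq0 (_ : 1 + 1 = 2%:R) // pnatr_eq0.
Qed.

(** Multiplication by [z] turns [1 + z ^+ n.-1] into [1 + z]. *)
Lemma qsum_shift_prim_root d : (0 < n)%N ->
  (1 + z) * qsum_shift z n d = z * (qsum z 1 n d + qsum z 2 n d).
Proof.
have z0 := prim_root_neq0 z_prim.
have := prim_expr_order z_prim; case: n => // m zm _.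
by rewrite -qsum_shiftE mulrA mulrDr mulr1 -exprS zm addrC.
Qed.

Lemma qsum1_odd d j : (d + (2 * j).+1 = n)%N ->
  qsum z 1 n d = (-1) ^+ ((n + d - 1) %/ 2) * z ^ odd_exponent n d.
Proof.
by move=> dn; rewrite (odd_monomialE dn); case: ((qsum_prim_root z_prim j d).2 dn).
Qed.

Lemma qsum1_even d j : (d + 2 * j = n)%N -> qsum z 1 n d = 0.
Proof. by move=> dn; case: ((qsum_prim_root z_prim j d).1 dn). Qed.

Lemma qsum_shift_odd d j : (d + (2 * j).+1 = n)%N ->
  qsum_shift z n d = (-1) ^+ ((n + d - 1) %/ 2) * z ^ odd_exponent n d.
Proof.
have z0 := prim_root_neq0 z_prim.
move=> dn; have [n2 | n2] := eqVneq n 2%N.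
  (* For [n = 2] the factor [1 + z] is zero; here only [k = 1] contributes, with an empty product,
     so the two sums agree. *)
  have [dE jE] : (d = 1 /\ j = 0)%N by lia.
  rewrite -(qsum1_odd dn) n2 dE /qsum /qsum_shift !big_nat_recr //= !big_geq //.
  by rewrite /qpoch !big_ord0 !mul1n; ring.
rewrite (odd_monomialE dn); have [s m] := (qsum_prim_root z_prim j d).2 dn.
apply: (mulfI (prim_root_add1_neq0 n2)); rewrite qsum_shift_prim_root; last lia.
by rewrite s m; field.
Qed.

Lemma qsum_shift_even d j : (d + 2 * j.+1 = n)%N ->
  qsum_shift z n d =
    (-1) ^+ ((n + d) %/ 2) * z ^ even_exponent n d * even_quotient z j.+1.
Proof.
have z0 := prim_root_neq0 z_prim.
move=> dn; rewrite (even_monomialE dn); have [n2 | n2] := eqVneq n 2%N.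
  have [dE jE] : (d = 0 /\ j = 0)%N by lia.
  have zN1 : z = -1.
    have := prim_expr_order z_prim; rewrite n2 => /eqP.
    rewrite sqrf_eq1 => /orP[/eqP z1|/eqP //]; have := prim_order_dvd z_prim 1.
    by rewrite z1 expr1n eqxx n2.
  rewrite n2 dE jE zN1 /even_quotient /qsum_shift !big_nat_recr //= !big_geq //.
  rewrite big_ord1 /qpoch big_ord1 big_ord0 /= !(exprS, expr0).
  by field.
apply: (mulfI (prim_root_add1_neq0 n2)); rewrite qsum_shift_prim_root; last lia.
have [-> ->] := (qsum_prim_root z_prim j.+1 d).1 dn.
rewrite (mulrCA (1 + z)) even_quotientE /odd_value.
(* The last two summands cancel the factor [z ^+ (2 * j.+1)] of [qsum z 2] and the factor [z] of
   [qsum_shift_prim_root]. *)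
have -> : ((3 * j.+1 * j.+2).+1 = (3 * j.+1 * j.+1 + j.+1) + (2 * j.+1) + 1)%N by lia.
rewrite (exprS (-1)) !(exprD z (_ + _)) expr1; field.
by rewrite z0 !expf_neq0.
Qed.

End Values.

(** * Compatibility with ring morphisms *)

Section Morphism.
Variables (R S : comNzRingType) (f : {rmorphism R -> S}).

Lemma rmorph_gauss q n k : f (gauss q n k) = gauss (f q) n k.
Proof.
elim: n k => [|n IHn] [|k]; rewrite ?gaussn0 ?rmorph1 ?rmorph0 //.
by rewrite !gaussSS rmorphD rmorphM rmorphXn !IHn.
Qed.

Lemma rmorph_qpoch z q n : f (qpoch z q n) = qpoch (f z) (f q) n.
Proof.
by rewrite rmorph_prod; apply: eq_bigr => i _; rewrite rmorphB rmorphM rmorphXn rmorph1.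
Qed.

Lemma rmorph_qsum q c n d : f (qsum q c n d) = qsum (f q) c n d.
Proof.
rewrite rmorph_sum; apply: eq_bigr => k _.
by rewrite !rmorphM rmorph_gauss rmorph_qpoch rmorphN !rmorphXn.
Qed.

Lemma rmorph_qsum_shift q n d : f (qsum_shift q n d) = qsum_shift (f q) n d.
Proof.
rewrite rmorph_sum; apply: eq_bigr => k _.
by rewrite !rmorphM rmorph_gauss rmorph_qpoch rmorphN !rmorphXn.
Qed.

End Morphism.

(** * The indeterminate, and divisibility by the cyclotomic polynomial *)

Lemma qvar_neq0 : qvar != 0.
Proof. by rewrite /qvar tofrac_eq0 polyX_eq0. Qed.

Lemma qvarXn_neq1 k : qvar ^+ k.+1 != 1.
Proof.
rewrite /qvar -rmorphXn -(rmorph1 (@FracField.tofrac _)) tofrac_eq.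
by apply/eqP => /(congr1 (fun p : {poly int} => size p)); rewrite size_polyXn size_poly1.
Qed.

Lemma qpoch_neq0 (F : fieldType) (q : F) n :
  (forall k, q ^+ k.+1 != 1) -> qpoch q q n != 0.
Proof.
by move=> q1; apply/prodf_neq0 => i _; rewrite -exprS subr_eq0 eq_sym.
Qed.

Lemma gauss_qpoch (R : comNzRingType) (q : R) n k : (k <= n)%N ->
  gauss q n k * (qpoch q q k * qpoch q q (n - k)) = qpoch q q n.
Proof.
elim: n k => [|n IHn] [|k] // le_kn.
- by rewrite gaussn0 /qpoch big_ord0 !mul1r.
- by rewrite gaussn0 subn0 {1}/qpoch big_ord0 !mul1r.
rewrite subSS !qpochSr -!exprS -(IHn k) //.
transitivity ((1 - q ^+ k.+1) * gauss q n.+1 k.+1 * (qpoch q q k * qpoch q q (n - k))); first by ring.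
by rewrite gauss_mul_diag; ring.
Qed.

Lemma qbinom_qvar n k : qbinom qvar n k = gauss qvar n k.
Proof.
rewrite /qbinom; case: leqP => [le_kn | lt_nk]; last by rewrite gauss_small.
have P m := qpoch_neq0 m qvarXn_neq1.
by rewrite -(gauss_qpoch _ le_kn) mulfK // mulf_neq0.
Qed.

(** ['Phi_n] is monic, so division by it stays in Z[q]; it is also the minimal polynomial of [z]
    over the rationals, so the remainder, of smaller degree and zero at [z], is zero. *)
Lemma Cyclotomic_dvd_root n (z : algC) (p : {poly int}) : n.-primitive_root z ->
  root (map_poly intr p) z -> exists g, p = 'Phi_n * g.
Proof.
move=> z_prim pz0; have Phi_monic := Cyclotomic_monic n.
exists (Pdiv.Ring.rdivp p 'Phi_n).
rewrite mulrC [LHS](Pdiv.RingMonic.rdivp_eq Phi_monic).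
set r := Pdiv.Ring.rmodp _ _; suff -> : r = 0 by rewrite addr0.
have lt_r : (size r < size 'Phi_n)%N by rewrite Pdiv.Ring.ltn_rmodp monic_neq0.
have rz0 : root (map_poly intr r) z.
  have := Pdiv.RingMonic.rdivp_eq Phi_monic p; rewrite -/r => Ep.
  have Phiz0 : root (map_poly intr 'Phi_n) z.
    by rewrite (Cintr_Cyclotomic z_prim) root_cyclotomic.
  move: pz0; rewrite /root Ep rmorphD rmorphM hornerD hornerM (rootP Phiz0).
  by rewrite mulr0 add0r.
have [mz [Dmz _ dv]] := minCpolyP z.
have rC : map_poly intr r = map_poly ratr (map_poly intr r) :> {poly algC}.
  by rewrite -map_poly_comp; apply: eq_map_poly => x /=; rewrite ratr_int.
move: rz0; rewrite rC dv => dv_r; apply: contraTeq lt_r => r0.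
rewrite -leqNgt -(size_map_inj_poly (@intr_inj algC)) // (Cintr_Cyclotomic z_prim).
rewrite -(minCpoly_cyclotomic z_prim) Dmz size_map_poly.
rewrite -(size_map_inj_poly (@intr_inj rat) _ r) //; apply: dvdp_leq => //.
by rewrite map_poly_eq0_id0 // intr_eq0 lead_coef_eq0.
Qed.

(** * Evaluation of Laurent polynomials at a root of unity *)

Section LaurentValue.
Variables (n : nat) (z : algC).
Hypothesis z_prim : n.-primitive_root z.

Definition poly_eval : {poly int} -> algC := horner_eval z \o map_poly intr.
HB.instance Definition _ := GRing.RMorphism.on poly_eval.

Lemma poly_evalX : poly_eval 'X = z.
Proof. by rewrite /poly_eval /= /horner_eval map_polyX hornerX. Qed.

(** Evaluation at [z] as a relation: this avoids choosing a representation of [x] as a polynomial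
    over a power of [qvar]. *)
Definition laurent_value (x : Zq_frac) (c : algC) : Prop :=
  exists p m, x = FracField.tofrac p / qvar ^+ m /\ c = poly_eval p / z ^+ m.

Lemma laurent_value_poly p : laurent_value (FracField.tofrac p) (poly_eval p).
Proof. by exists p, 0%N; rewrite !divr1. Qed.

Lemma laurent_valueM x y a b :
  laurent_value x a -> laurent_value y b -> laurent_value (x * y) (a * b).
Proof.
move=> [p [m [-> ->]]] [p' [m' [-> ->]]]; exists (p * p'), (m + m')%N.
by rewrite !rmorphM !exprD !mulf_div.
Qed.

Lemma laurent_value_sign k : laurent_value ((-1) ^+ k) ((-1) ^+ k).
Proof.
have := laurent_value_poly ((-1) ^+ k).
by rewrite !rmorphXn !rmorphN !rmorph1.
Qed.

Lemma laurent_value_exprz (e : int) : laurent_value (qvar ^ e) (z ^ e).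
Proof.
case: e => m; last by exists 1, m.+1; rewrite !rmorph1 !div1r.
have := laurent_value_poly 'X^m.
by rewrite !rmorphXn /= poly_evalX.
Qed.

(** With denominators cleared, the difference is a polynomial vanishing at [z], hence a multiple of
    ['Phi_n]. *)
Lemma laurent_value_eqmod x y c :
  laurent_value x c -> laurent_value y c -> laurent_eqmod 'Phi_n x y.
Proof.
have z0 : z != 0 := prim_root_neq0 z_prim.
have q0 := qvar_neq0.
move=> [p [m [-> Ec]]] [p' [m' [-> Ec']]].
split; [by exists p, m | by exists p', m' |].
have [g Eg] : exists g, p * 'X^m' - p' * 'X^m = 'Phi_n * g.
  apply: (Cyclotomic_dvd_root z_prim); apply/eqP.
  change (poly_eval (p * 'X^m' - p' * 'X^m) = 0).
  rewrite rmorphB !rmorphM !rmorphXn /= poly_evalX.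
  have [zm zm'] : z ^+ m != 0 /\ z ^+ m' != 0 by rewrite !expf_neq0.
  have -> : poly_eval p = c * z ^+ m by rewrite Ec divfK.
  have -> : poly_eval p' = c * z ^+ m' by rewrite Ec' divfK.
  by ring.
exists (FracField.tofrac g / qvar ^+ (m + m')); first by exists g, (m + m')%N.
rewrite mulrA -rmorphM -Eg rmorphB !rmorphM !rmorphXn -/qvar exprD.
by rewrite -[in LHS]mulNr addf_div ?expf_neq0 // mulNr.
Qed.

End LaurentValue.

Lemma laurent_value_qsum z c n d : laurent_value z (qsum qvar c n d) (qsum z c n d).
Proof.
by have := laurent_value_poly z (qsum 'X c n d); rewrite !rmorph_qsum /= poly_evalX.
Qed.

Lemma laurent_value_qsum_shift z n d :
  laurent_value z (qsum_shift qvar n d) (qsum_shift z n d).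
Proof.
by have := laurent_value_poly z (qsum_shift 'X n d); rewrite !rmorph_qsum_shift /= poly_evalX.
Qed.

Lemma rmorph_even_quotient (R S : comNzRingType) (f : {rmorphism R -> S}) q j :
  f (even_quotient q j) = even_quotient (f q) j.
Proof.
rewrite rmorphM rmorphB rmorph1 rmorph_sum; congr (_ * _).
by apply: eq_bigr => i _; rewrite rmorphXn.
Qed.

(** The division is carried out before evaluation, because [1 + z] may be zero. *)
Lemma laurent_value_even_quotient z j :
  laurent_value z ((1 - qvar ^+ (2 * j)) / (1 + qvar)) (even_quotient z j).
Proof.
have q1 : 1 + qvar != 0.
  apply: contraNneq (qvarXn_neq1 1) => /eqP.
  by rewrite addrC addr_eq0 => /eqP ->; rewrite sqrrN expr1n.
rewrite -even_quotientE mulrC mulKf //.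
by have := laurent_value_poly z (even_quotient 'X j); rewrite !rmorph_even_quotient /= poly_evalX.
Qed.

Unset Implicit Arguments.

Theorem corollary4p2 (n d : nat) (hn : (1 <= n)%N) (hd : (d < n)%N) :
  laurent_eqmod 'Phi_n
    (\sum_(0 <= k < n) qvar ^+ k * qbinom qvar (2 * k) (k + d)
        * qpoch (- qvar ^+ k.+1) qvar (n - k - 1))
    (if odd (n - d) then
       (-1) ^+ ((n + d - 1) %/ 2)
       * qvar ^ ((d%:Z * (2 * n%:Z - 3 * d%:Z) - (n%:Z + 1) ^+ 2) %/ 4)%Z
     else 0)
  /\
  laurent_eqmod 'Phi_n
    (\sum_(0 <= k < n) qvar ^+ k * qbinom qvar (2 * k) (k + d)
        * qpoch (- qvar ^+ k) qvar (n - k - 1))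
    (if odd (n - d) then
       (-1) ^+ ((n + d - 1) %/ 2)
       * qvar ^ ((d%:Z * (2 * n%:Z - 3 * d%:Z) - (n%:Z + 1) ^+ 2) %/ 4)%Z
     else
       (-1) ^+ ((n + d) %/ 2)
       * qvar ^ ((d%:Z * (2 * n%:Z - 3 * d%:Z) - n%:Z ^+ 2 + 2 * d%:Z) %/ 4)%Z
       * ((1 - qvar ^+ (n - d)) / (1 + qvar))).
Proof.
have [z z_prim] := C_prim_root_exists hn.
set S1 := \sum_(0 <= k < n) _; set S2 := \sum_(0 <= k < n) _.
have -> : S1 = qsum qvar 1 n d.
  by apply: eq_bigr => k _; rewrite qbinom_qvar mul1n.
have -> : S2 = qsum_shift qvar n d.
  by apply: eq_bigr => k _; rewrite qbinom_qvar.
rewrite -/(odd_exponent n d) -/(even_exponent n d).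
have v1 := laurent_value_qsum z 1 n d; have v2 := laurent_value_qsum_shift z n d.
have vM k e := laurent_valueM (laurent_value_sign z k) (laurent_value_exprz z e).
case: ifPn => [nd_odd | nd_even].
  have dn : (d + (2 * (n - d)./2).+1 = n)%N by lia.
  split; [apply: (laurent_value_eqmod z_prim v1) | apply: (laurent_value_eqmod z_prim v2)].
    by rewrite (qsum1_odd z_prim dn); apply: vM.
  by rewrite (qsum_shift_odd z_prim dn); apply: vM.
(* As [d < n], the even number [n - d] is positive, which permits the form [2 * j.+1]. *)
have [j dn] : exists j, (d + 2 * j.+1 = n)%N by exists (n - d)./2.-1; lia.
split; [apply: (laurent_value_eqmod z_prim v1) | apply: (laurent_value_eqmod z_prim v2)].
  rewrite (qsum1_even z_prim dn) -(rmorph0 (poly_eval z)) -(rmorph0 (@FracField.tofrac _)).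
  exact: laurent_value_poly.
rewrite (qsum_shift_even z_prim dn) (_ : n - d = 2 * j.+1)%N; last lia.
exact: laurent_valueM (vM _ _) (laurent_value_even_quotient _ _).
Qed.
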